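(* Let $N$ be a binary matroid. If $N$ dismantles to the loop $M^\ell(K_1)$ or to the edge $M(K_2)$, then the problem $\mathrm{Recol}_{\mathbb M}(N)$ is trivial.
   Context: All matroids are finite binary matroids (representable by a matrix over $\mathbb Z_2$) and are simple only in the sense that the columns of the representing matrix are distinct; here matroids may have a loop (a one-point circuit, i.e. a zero column). $E(M)$ denotes the set of points of $M$. A matroid homomorphism $\tau:M\to N$ is a map $\tau:E(M)\to E(N)$ such that for every circuit $Z$ of $M$, $\tau(Z)$, computed mod 2 (the set of points of $N$ having an odd number of preimages in $Z$), is a (possibly empty) disjoint union of circuits of $N$. Equivalently, for a fixed representation of $N$ by columns over $\mathbb Z_2$, $\sum_{e\in Z}\tau(e)=0$ for every circuit $Z$ of $M$. The graph $\mathrm{Col}_{\mathbb M}(M,N)$ has as vertices all matroid homomorphisms $M\to N$; two vertices $\tau,\tau'$ are adjacent if there is a cocircuit $C$ of $M$ such that, for $e\in E(M)$, $\tau(e)\ne\tau'(e)$ if and only if $e\in C$. $\mathrm{Recol}_{\mathbb M}(N)$ is the problem: Instance: a binary matroid $M$ and two vertices $\tau,\sigma$ of $\mathrm{Col}_{\mathbb M}(M,N)$. Decision: is there a path in $\mathrm{Col}_{\mathbb M}(M,N)$ between $\tau$ and $\sigma$? The problem is trivial if all instances are YES instances. A surjective homomorphism $r:M\to M'$ is a retraction if there is a homomorphism $c:M'\to M$ with $r\circ c$ the identity on $M'$; then $M'$ is identified with the submatroid $c(M')$ of $M$, which is fixed pointwise by $r$, so $r$ is viewed as an element of $\mathrm{Col}_{\mathbb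 M}(M,M)$. A retraction $r\in\mathrm{Col}_{\mathbb M}(N,N)$ is a dismantling retraction if it is adjacent to the identity map in $\mathrm{Col}_{\mathbb M}(N,N)$. $N$ dismantles to $N'$ if there is a (possibly empty) finite series of dismantling retractions $N=N_0\to N_1\to\dots\to N_k=N'$ whose composition takes $N$ to its retract $N'$ (matroids considered up to isomorphism). $M^\ell(K_1)$ is the matroid with a single point that is a loop; $M(K_2)$ is the matroid with a single point that is not a loop. *)

(* Defs.v *)
From HB Require Import structures.
From mathcomp Require Import all_boot all_order all_algebra.

Set Implicit Arguments.
Unset Strict Implicit.
Unset Printing Implicit Defensive.

Import GRing.Theory.

Record matroid := Matroid {
  ground :> finType;
  indep : pred {set ground};
  indep0 : indep set0;
  indepS : forall A B : {set ground}, A \subset B -> indep B -> indep A;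
  indep_aug : forall A B : {set ground}, indep A -> indep B -> #|A| < #|B| ->
    exists2 x, x \in B :\: A & indep (x |: A)
}.

Definition circuit (M : matroid) (Z : {set M}) : bool :=
  minset (fun A : {set M} => ~~ indep A) Z.

Definition basis (M : matroid) (B : {set M}) : bool :=
  maxset (@indep M) B.

(* The bases of the dual matroid are the complements of the bases of M, so a
   set is independent in the dual iff it misses some basis of M. *)
Definition coindep (M : matroid) (A : {set M}) : bool :=
  [exists B : {set M}, basis B && [disjoint A & B]].

Definition cocircuit (M : matroid) (C : {set M}) : bool :=
  minset (fun A : {set M} => ~~ coindep A) C.

(* The columns of the representing matrix are indexed by the ground set; they
   are distinct, but one of them may be zero (a loop). *)
Definition binary (M : matroid) : Prop :=
  exists n (c : M -> 'cV['F_2]_n),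
    injective c /\ forall A : {set M}, indep A = free [seq c e | e in A].

Record binMatroid := BinMatroid {
  bin_matroid :> matroid;
  bin_matroidP : binary bin_matroid
}.

Definition isomorphic (M N : binMatroid) : Prop :=
  exists f : M -> N,
    bijective f /\ forall A : {set M}, indep (f @: A) = indep A.

(* The image of Z computed mod 2. *)
Definition odd_image (M N : binMatroid) (tau : M -> N) (Z : {set M}) : {set N} :=
  [set y | odd #|[set e in Z | tau e == y]|].

Definition circuit_union (N : binMatroid) (X : {set N}) : bool :=
  [exists P : {set {set N}}, partition P X && [forall Z in P, circuit Z]].

Definition is_hom (M N : binMatroid) (tau : {ffun M -> N}) : bool :=
  [forall Z : {set M}, circuit Z ==> circuit_union (odd_image tau Z)].

Record hom (M N : binMatroid) := Hom {
  hom_fun :> {ffun M -> N};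
  hom_funP : is_hom hom_fun
}.

HB.instance Definition _ (M N : binMatroid) :=
  [isSub for @hom_fun M N].
HB.instance Definition _ (M N : binMatroid) :=
  [Countable of hom M N by <:].
HB.instance Definition _ (M N : binMatroid) :=
  [Finite of hom M N by <:].

Lemma id_is_hom (N : binMatroid) : is_hom [ffun e : N => e].
Proof.
apply/forall_inP => Z circZ; apply/existsP; exists [set Z].
have -> : odd_image [ffun e : N => e] Z = Z.
  apply/setP => y; rewrite inE; have [yZ|yNZ] := boolP (y \in Z).
    rewrite (_ : [set e in Z | _] = [set y]) ?cards1 //.
    by apply/setP => e; rewrite !inE ffunE; case: eqP => [->|_]; rewrite ?yZ ?andbF.
  rewrite (_ : [set e in Z | _] = set0) ?cards0 //.
  apply/setP => e; rewrite !inE ffunE.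
  by case: eqP => [->|_]; rewrite ?(negPf yNZ) ?andbF.
apply/andP; split; last by apply/forall_inP => A /set1P ->.
rewrite /partition cover1 eqxx trivIset1 inE eq_sym /=.
by apply: contraTneq (minsetp circZ) => ->; rewrite indep0.
Qed.

Definition hom_id (N : binMatroid) : hom N N := Hom (id_is_hom N).

Definition Col (M N : binMatroid) : rel (hom M N) := fun tau tau' =>
  [exists C : {set M},
    cocircuit C && [forall e, (tau e != tau' e) == (e \in C)]].

Record Recol_instance (N : binMatroid) := RecolInstance {
  inst_matroid : binMatroid;
  inst_source : hom inst_matroid N;
  inst_target : hom inst_matroid N
}.

Definition Recol (N : binMatroid) (I : Recol_instance N) : bool :=
  connect (@Col (inst_matroid I) N) (inst_source I) (inst_target I).

Definition Recol_trivial (N : binMatroid) : Prop :=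
  forall I : Recol_instance N, Recol I.

Definition retraction (M M' : binMatroid) (r : hom M M') (c : hom M' M) : Prop :=
  (forall y : M', exists x : M, r x = y) /\ (forall y : M', r (c y) = y).

(* Identifying N' with the submatroid c(N') of N turns r into the endomorphism
   rho = c \o r, which is the map required to be adjacent to the identity. *)
Definition dismantling_retraction (N N' : binMatroid) (r : hom N N') : Prop :=
  exists c : hom N' N, retraction r c /\
    exists rho : hom N N, (forall e : N, rho e = c (r e)) /\ Col rho (hom_id N).

(* Allowing an isomorphism at the end suffices: retractions r, c onto N1 can be
   transported along any isomorphism of N1. *)
Inductive dismantles : binMatroid -> binMatroid -> Prop :=
| dismantles_iso N N' : isomorphic N N' -> dismantles N N'
| dismantles_step N N1 N' (r : hom N N1) :
    dismantling_retraction r -> dismantles N1 N' -> dismantles N N'.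

Lemma loop_indepS (A B : {set unit}) : A \subset B -> B == set0 -> A == set0.
Proof. by move=> sAB /eqP B0; rewrite -subset0 -B0. Qed.

Lemma loop_indep_aug (A B : {set unit}) : A == set0 -> B == set0 ->
  #|A| < #|B| -> exists2 x, x \in B :\: A & x |: A == set0.
Proof. by move=> /eqP-> /eqP->; rewrite ltnn. Qed.

Definition loop_matroid : matroid :=
  @Matroid unit (fun A => A == set0) (eqxx _) loop_indepS loop_indep_aug.

Lemma edge_indep_aug (A B : {set unit}) : true -> true ->
  #|A| < #|B| -> exists2 x, x \in B :\: A & true.
Proof.
move=> _ _ ltAB; have /set0Pn[x xBA] : B :\: A != set0.
  by rewrite setD_eq0; apply: contraL ltAB => /subset_leq_card; rewrite -leqNgt.
by exists x.
Qed.

Definition edge_matroid : matroid :=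
  @Matroid unit (fun=> true) isT (fun _ _ _ _ => isT) edge_indep_aug.

Lemma set_unitP (A : {set unit}) : A = set0 \/ A = [set tt].
Proof.
case: (boolP (tt \in A)) => tA; [right | left]; apply/setP => -[];
  by rewrite !inE ?tA ?(negPf tA).
Qed.

Lemma loop_binary : binary loop_matroid.
Proof.
exists 1, (fun=> 0%R); split=> [[] [] //|A] /=.
rewrite /image_mem; case: (set_unitP A) => ->.
  by rewrite enum_set0 eqxx nil_free.
rewrite enum_set1 /= seq1_free eqxx.
by apply/negP => /eqP/setP/(_ tt); rewrite !inE.
Qed.

Lemma edge_binary : binary edge_matroid.
Proof.
exists 1, (fun=> const_mx 1%R); split=> [[] [] //|A] /=.
rewrite /image_mem; case: (set_unitP A) => ->.
  by rewrite enum_set0 nil_free.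
rewrite enum_set1 /= seq1_free; apply/esym/eqP => /matrixP/(_ ord0 ord0).
by rewrite !mxE.
Qed.

Definition loop : binMatroid := BinMatroid loop_binary.
Definition edge : binMatroid := BinMatroid edge_binary.

(* Main.v *)
Require Import Defs.
From mathcomp Require Import all_boot all_order all_algebra.
(* The vector space theory has a hom of its own; matroid homomorphisms win. *)
Import Defs.

Set Implicit Arguments.
Unset Strict Implicit.
Unset Printing Implicit Defensive.

Import GRing.Theory.
Local Open Scope ring_scope.

(** Write the columns representing N as a map c from N to a vector space V over
    F_2, and call a map f from the points of a matroid to V a cocycle when it
    sums to zero over every circuit. A map tau into N is a homomorphism exactly
    when c o tau is a cocycle ([is_homP]), so homomorphisms can be added and
    subtracted.

    Two facts link cocycles with cocircuits: the support of a nonzero cocycle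
    contains a cocircuit ([cocycle_cocircuit]), and in a binary matroid the
    indicator of a cocircuit is a cocycle ([cocircuit_cocycle]). By minimality
    of cocircuits, a cocycle supported in a cocircuit C is then constant on C
    ([cocycle_const]).

    Let rho be a dismantling retraction followed by its section, moving exactly
    the points of the cocircuit C of N. The cocycle c o rho - c is supported in
    C, so rho adds one and the same vector v to every point it moves. Hence for
    each homomorphism tau into N, rho o tau is obtained from tau by adding v on
    some set of points. That set, if nonempty, contains a cocircuit D; adding v
    on D only is again a homomorphism, since c o tau + v 1_D is a cocycle, and
    it is adjacent to tau. Repeating on what remains of the set gives a path
    from tau to rho o tau ([connect_translate]).

    So any tau and sigma are joined to rho o tau and rho o sigma, which factor
    through the retract; a path between the factors is carried back to N by the
    section of the retraction. Thus triviality of the recolouring problem passes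
    from the retract to N, and it holds for a matroid with a single point, into
    which there is at most one map. *)

(** * Linear algebra *)

Lemma free_imageP (K : fieldType) (V : vectType K) (I : finType) (c : I -> V)
    (A : {set I}) :
  reflect (forall k : I -> K, \sum_(i in A) k i *: c i = 0 ->
             forall i, i \in A -> k i = 0)
          (free [seq c i | i in A]).
Proof.
have sz : size [seq c i | i in A] == #|A| by rewrite size_image.
have nthE (j : 'I_#|A|) : (Tuple sz)`_j = c (enum_val j).
  exact: nth_image.
have sumE (k : I -> K) : \sum_(i in A) k i *: c i =
    \sum_(j < #|A|) k (enum_val j) *: (Tuple sz)`_j.
  by rewrite big_enum_val; apply: eq_bigr => j _; rewrite nthE.
apply: (iffP (freeP (X := Tuple sz))) => [freeA k k0 i iA | freeA k k0 j].
  rewrite -(enum_rankK_in iA iA).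
  by apply: (freeA (fun j => k (enum_val j))); rewrite -sumE.
(* The coefficients k, indexed by ranks in A, as a function on all of I. *)
pose k' i := if boolP (i \in A) is AltTrue iA then k (enum_rank_in iA i) else 0.
have k'E j' : k' (enum_val j') = k j'.
  rewrite /k'; case: {-}_ / boolP => [iA|]; last by rewrite enum_valP.
  by rewrite enum_valK_in.
rewrite -k'E; apply: freeA (enum_valP j); rewrite sumE -[RHS]k0.
by apply: eq_bigr => i _; rewrite k'E.
Qed.

Lemma F2_neq0 (x : 'F_2) : x != 0 -> x = 1.
Proof. by case: x => [[|[|]]] // lt2 _; apply: val_inj. Qed.

Lemma mulrn_odd (V : lmodType 'F_2) (v : V) n : v *+ n = v *+ odd n.
Proof.
rewrite -{1}[n]odd_double_half mulrnDr -mul2n mulrnA -[v *+ 2]scaler_nat.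
by rewrite pchar_Fp_0 // scale0r mul0rn addr0.
Qed.

(** * Cocycles of a matroid *)

Section Cocycles.
Variable M : matroid.
Implicit Types (A B C D X Z : {set M}) (e x y : M).

Definition cocycle (V : zmodType) (f : M -> V) : Prop :=
  forall Z, circuit Z -> \sum_(e in Z) f e = 0.

Lemma dep_circuit A : ~~ indep A -> exists2 Z, circuit Z & Z \subset A.
Proof.
by case/(@minset_exists _ (fun B : {set M} => ~~ indep B)) => Z; exists Z.
Qed.

Lemma mem_circuitU1 A Z x :
  indep A -> circuit Z -> Z \subset x |: A -> x \in Z.
Proof.
move=> indA circZ sZ; apply: contraLR (minsetp circZ) => xNZ; rewrite negbK.
apply: indepS indA; apply/subsetP => y yZ.
by have:= subsetP sZ y yZ; rewrite !inE; case: eqP yZ xNZ => // -> ->.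
Qed.

(** A circuit inside x |: A would contain x, and x would contribute the only
    nonzero term to the sum of f over it. *)
Lemma indepU1_cocycle (V : zmodType) (f : M -> V) A x :
  cocycle f -> indep A -> {in A, forall y, f y = 0} -> f x != 0 ->
  indep (x |: A).
Proof.
move=> cocf indA f0 fx; apply: contraNT fx => /dep_circuit[Z circZ sZ].
have xZ := mem_circuitU1 indA circZ sZ.
rewrite -(cocf Z circZ) (big_setD1 x) //= big1 ?addr0 // => y.
rewrite !inE => /andP[yx yZ]; apply: f0.
by have:= subsetP sZ y yZ; rewrite !inE (negPf yx).
Qed.

(** A basis disjoint from the support of f could be enlarged by any point of the
    support, by [indepU1_cocycle]. *)
Lemma cocycle_support_codep (V : zmodType) (f : M -> V) A e :
  cocycle f -> f e != 0 -> (forall x, f x != 0 -> x \in A) -> ~~ coindep A.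
Proof.
move=> cocf fe suppA; apply/existsP => -[B /andP[basB disB]].
have fB : {in B, forall y, f y = 0}.
  move=> y yB; apply/eqP; apply: contraTT yB => /suppA yA.
  by rewrite (disjointFr disB yA).
have := indepU1_cocycle cocf (maxsetp basB) fB fe.
move/(maxsetsup basB)/(_ (subsetUr _ _)) => eB.
by move: fe; rewrite fB ?eqxx // -eB setU11.
Qed.

Lemma cocycle_cocircuit (V : zmodType) (f : M -> V) e :
  cocycle f -> f e != 0 ->
  exists2 C, cocircuit C & {in C, forall x, f x != 0}.
Proof.
move=> cocf fe; pose S := [set x | f x != 0].
have : ~~ coindep S.
  by apply: cocycle_support_codep cocf fe _ => x; rewrite inE.
case/(@minset_exists _ (fun A : {set M} => ~~ coindep A)) => C cocC sCS.
by exists C => // x /(subsetP sCS); rewrite inE.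
Qed.

Definition represents (V : vectType 'F_2) (c : M -> V) : Prop :=
  forall A, indep A = free [seq c e | e in A].

Lemma cocircuit_nonempty C : cocircuit C -> exists e, e \in C.
Proof.
move/minsetp => depC; apply/set0Pn; apply: contraNneq depC => ->.
have [B basB _] := maxset_exists (indep0 M).
apply/existsP; exists B; rewrite /basis basB /=.
by rewrite disjoints_subset sub0set.
Qed.

Lemma basis_card A B : basis B -> indep A -> #|A| = #|B| -> basis A.
Proof.
move=> basB indA cardA; apply/maxsetP; split=> // A' indA' sAA'.
apply/eqP; rewrite eq_sym eqEcard sAA' leqNgt cardA; apply/negP => ltBA'.
have [x /setDP[_ xNB] indxB] := indep_aug (maxsetp basB) indA' ltBA'.
by move: xNB; rewrite -(maxsetsup basB indxB (subsetUr _ _)) setU11.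
Qed.

Section Representation.
Variables (V : vectType 'F_2) (c : M -> V).
Hypothesis repc : represents c.

(** Over F_2 the coefficients of a linear relation are recorded by its support,
    so dependence can be read off from subsets alone. *)
Lemma dep_nullP A :
  reflect (exists X, [/\ X \subset A, X != set0 & \sum_(e in X) c e = 0])
          (~~ indep A).
Proof.
rewrite repc; apply: (iffP idP) => [depA | [X [sXA /set0Pn[e eX] X0]]].
  have [/existsP[X /and3P[? ? /eqP ?]]|/existsPn noX] :=
    boolP [exists X : {set M},
             [&& X \subset A, X != set0 & \sum_(e in X) c e == 0]].
    by exists X.
  case/free_imageP: depA => k k0 i iA; apply/eqP/contraT => ki.
  have /negP[] := noX [set j in A | k j != 0]; apply/and3P; split.
  - by apply/subsetP => j; rewrite inE => /andP[].
  - by apply/set0Pn; exists i; rewrite inE iA.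
  apply/eqP; rewrite -[RHS]k0 [RHS](bigID (fun j => k j != 0)) /=.
  rewrite [X in _ + X]big1 ?addr0.
    apply: eq_big => j; rewrite inE // => /andP[_ /F2_neq0->].
    by rewrite scale1r.
  by move=> j /andP[_]; rewrite negbK => /eqP->; rewrite scale0r.
apply/free_imageP => /(_ (fun j => (j \in X)%:R)) frA.
have /eqP : (e \in X)%:R = 0 :> 'F_2.
  apply: frA (subsetP sXA e eX); rewrite -[RHS]X0 (big_setID X) /= (setIidPr sXA).
  rewrite [X in _ + X]big1 ?addr0 => [|j /setDP[_ /negPf->]]; last exact: scale0r.
  by apply: eq_bigr => j ->; rewrite scale1r.
by rewrite eX oner_eq0.
Qed.

Lemma rep_cocycle : cocycle c.
Proof.
move=> Z circZ; have /dep_nullP[X [sXZ Xn0 X0]] := minsetp circZ.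
have <- // : X = Z.
by apply: minsetinf circZ _ sXZ; apply/dep_nullP; exists X.
Qed.

Lemma basis_span B x :
  basis B -> exists k : M -> 'F_2, c x = \sum_(y in B) k y *: c y.
Proof.
move=> basB; have [xB|xNB] := boolP (x \in B).
  exists (fun y => (y == x)%:R); rewrite (big_setD1 x) //= eqxx scale1r.
  by rewrite big1 ?addr0 // => y; rewrite !inE => /andP[/negPf-> _]; rewrite scale0r.
have /dep_circuit[Z circZ sZ] : ~~ indep (x |: B).
  apply: contra xNB => /(maxsetsup basB)/(_ (subsetUr _ _)) <-; exact: setU11.
have xZ := mem_circuitU1 (maxsetp basB) circZ sZ.
exists (fun y => - (y \in Z)%:R).
move/eqP: (rep_cocycle circZ); rewrite (big_setD1 x) //= addr_eq0 => /eqP ->.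
rewrite -sumrN [RHS](big_setID Z) /= [X in _ + X]big1 ?addr0; last first.
  by move=> y /setDP[_ /negPf ->]; rewrite oppr0 scale0r.
have -> : B :&: Z = Z :\ x.
  apply/setP => y; rewrite !inE; have [yZ|] := boolP (y \in Z); rewrite ?andbF //.
  have:= subsetP sZ y yZ; rewrite !inE andbT; case: eqP => [->|_] /=; last by move=> ->.
  by rewrite (negPf xNB).
by apply: eq_bigr => y; rewrite inE => /andP[_ ->]; rewrite scaleNr scale1r.
Qed.

(** For e in C, minimality gives a basis B that meets C in e alone. Taking the
    coordinate on c e in the basis of columns indexed by B is a linear
    functional, hence a cocycle; it vanishes at every x outside C, for otherwise
    exchanging e for x would turn B into a basis that misses C. Its support is
    therefore C, again by minimality. *)
Lemma cocircuit_cocycle C :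
  cocircuit C -> cocycle (fun e => (e \in C)%:R : 'F_2).
Proof.
move=> cocC; have [e eC] := cocircuit_nonempty cocC.
have [depC minC] := minsetP cocC.
have /existsP[B /andP[basB disB]] : coindep (C :\ e).
  apply/contraT => /minC/(_ (subsetDl _ _)) eqC.
  by move: eC; rewrite -eqC !inE eqxx.
have eB : e \in B.
  apply: contraNT depC => eNB; apply/existsP; exists B; rewrite basB /=.
  rewrite disjoints_subset; apply/subsetP => y yC; rewrite inE.
  have [->//|ye] := eqVneq y e.
  by rewrite (disjointFr disB) // !inE ye.
have [k kE] := fin_all_exists (fun x => basis_span x basB).
have indB := maxsetp basB.
have /free_imageP freeB : free [seq c y | y in B] by rewrite -repc.
have kB x : x \in B -> k x e = (x == e)%:R.
  move=> xB; apply/eqP; rewrite -subr_eq0 eq_sym; apply/eqP/esym.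
  apply: (freeB (fun y => k x y - (x == y)%:R)) => //.
  under eq_bigr do rewrite scalerBl.
  rewrite sumrB -kE (big_setD1 x) //= eqxx scale1r big1 ?addr0 ?subrr // => y.
  by rewrite !inE eq_sym => /andP[/negPf-> _]; rewrite scale0r.
have cock : cocycle (fun x => k x e).
  move=> Z circZ; apply: (freeB (fun y => \sum_(x in Z) k x y)) => //.
  rewrite -[RHS](rep_cocycle circZ); under [RHS]eq_bigr do rewrite kE.
  by rewrite exchange_big /=; apply: eq_bigr => y _; rewrite scaler_suml.
have ke : k e e != 0 by rewrite kB // eqxx oner_eq0.
have supp x : k x e != 0 -> x \in C.
  move=> kx; apply: contraNT depC => xNC.
  have [exe|xe] := eqVneq x e; first by rewrite exe eC in xNC.
  have indx : indep (x |: B :\ e).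
    apply: indepU1_cocycle cock _ _ kx; first exact: indepS (subsetDl _ _) indB.
    by move=> y; rewrite !inE => /andP[/negPf ye yB]; rewrite kB // ye.
  have xNB : x \notin B.
    by apply: contraNN kx => xB; rewrite kB // (negPf xe).
  have basx : basis (x |: B :\ e).
    apply: basis_card basB indx _.
    by rewrite cardsU1 [#|B|](cardsD1 e) eB !inE (negPf xNB) andbF.
  apply/existsP; exists (x |: B :\ e); rewrite basx /=.
  rewrite disjoints_subset; apply/subsetP => y yC; rewrite !inE.
  have -> : (y == x) = false by apply: contraNF xNC => /eqP <-.
  have [//|ye] /= := eqVneq y e.
  by rewrite (disjointFr disB) // !inE ye.
pose S := [set x | k x e != 0].
have SC : S = C.
  apply: minC; last by apply/subsetP => x; rewrite inE => /supp.
  by apply: cocycle_support_codep cock ke _ => x; rewrite inE.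
move=> Z circZ; rewrite -[RHS](cock Z circZ); apply: eq_bigr => x _.
by rewrite -SC inE; case: eqP => [-> //|/eqP/F2_neq0 ->].
Qed.

Lemma cocircuit_cocycleZ (W : lmodType 'F_2) (w : W) C :
  cocircuit C -> cocycle (fun e => (e \in C)%:R *: w).
Proof.
move=> cocC Z circZ.
by rewrite -scaler_suml (cocircuit_cocycle cocC) ?scale0r.
Qed.

(** Subtracting f y times the indicator of C gives a cocycle supported in C
    minus y. The support of a nonzero cocycle is codependent, while C minus y is
    not, as C is a minimal codependent set; so the difference is zero. *)
Lemma cocycle_const (W : lmodType 'F_2) (f : M -> W) C :
  cocircuit C -> cocycle f -> (forall x, f x != 0 -> x \in C) ->
  {in C &, forall x y, f x = f y}.
Proof.
move=> cocC cocf supp x y xC yC; apply/eqP; rewrite -subr_eq0.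
apply: contraT => fxy; pose g z := f z - (z \in C)%:R *: f y.
have cocg : cocycle g.
  by move=> Z circZ; rewrite sumrB cocf // cocircuit_cocycleZ ?subr0.
have /minsetP[_ /(_ (C :\ y))/(_ _ (subsetDl _ _)) eqC] := cocC.
have /eqC/setP/(_ y) : ~~ coindep (C :\ y).
  apply: (cocycle_support_codep (e := x) cocg); first by rewrite /g xC scale1r.
  move=> z; rewrite /g !inE; have [->|zy] /= := eqVneq z y.
    by rewrite yC scale1r subrr eqxx.
  apply: contraNT => zNC; rewrite (negPf zNC) scale0r subr0.
  by apply: contraNT zNC => /supp.
by rewrite !inE eqxx yC.
Qed.

End Representation.
End Cocycles.

(** * Homomorphisms as cocycles *)

Lemma circuit_union_sum (N : binMatroid) (V : zmodType) (f : N -> V)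
    (X : {set N}) :
  cocycle f -> circuit_union X -> \sum_(e in X) f e = 0.
Proof.
move=> cocf /existsP[P /andP[partP /forall_inP circP]].
by rewrite (set_partition_big _ partP) big1 // => Z /circP/cocf.
Qed.

(** A nonempty set of columns with sum zero is dependent; removing a circuit
    from it leaves a smaller set with sum zero. *)
Lemma null_circuit_union (N : binMatroid) (V : vectType 'F_2) (c : N -> V)
    (X : {set N}) :
  represents c -> \sum_(e in X) c e = 0 -> circuit_union X.
Proof.
move=> repc; have [m] := ubnP #|X|; elim: m X => // m IHm X ltXm X0.
have [->|Xn0] := eqVneq X set0.
  apply/existsP; exists set0; rewrite partition_set0 eqxx /=.
  by apply/forall_inP => Z; rewrite inE.
have [Z circZ sZX] : exists2 Z, circuit Z & Z \subset X.
  by apply: dep_circuit; apply/(dep_nullP repc); exists X.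
have Zn0 : Z != set0.
  by apply: contraTneq (minsetp circZ) => ->; rewrite indep0.
have /existsP[P /andP[partP /forall_inP circP]] : circuit_union (X :\: Z).
  apply: IHm.
    apply: (@leq_trans #|X|) ltXm; rewrite -(cardsID Z X) (setIidPr sZX).
    by rewrite -[ltnLHS]add0n ltn_add2r card_gt0.
  by move: X0; rewrite (big_setID Z) /= (setIidPr sZX) (rep_cocycle repc) ?add0r.
apply/existsP; exists (Z |: P); apply/andP; split.
  rewrite -(setID X Z) (setIidPr sZX) partitionU1 //.
  by rewrite disjoints_subset setCD subsetUr.
by apply/forall_inP => Y /setU1P[->|/circP].
Qed.

Section Homs.
Variables (M N : binMatroid).

(** In characteristic 2, reducing the image of Z mod 2 discards only terms that
    cancel. *)
Lemma odd_image_sum (V : lmodType 'F_2) (f : N -> V) (tau : M -> N)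
    (Z : {set M}) :
  \sum_(y in odd_image tau Z) f y = \sum_(e in Z) f (tau e).
Proof.
rewrite [RHS](partition_big tau predT) //= [LHS]big_mkcond; apply: eq_bigr => y _.
under [RHS]eq_bigr => e /andP[_ /eqP->] do over.
rewrite sumr_const mulrn_odd inE cardsE.
by case: odd.
Qed.

Lemma cocycle_comp (V : lmodType 'F_2) (f : N -> V) (tau : {ffun M -> N}) :
  is_hom tau -> cocycle f -> cocycle (fun e => f (tau e)).
Proof.
move=> /forall_inP homtau cocf Z /homtau /(circuit_union_sum cocf).
by rewrite odd_image_sum.
Qed.

Lemma is_homP (V : vectType 'F_2) (c : N -> V) (tau : {ffun M -> N}) :
  represents c -> is_hom tau <-> cocycle (fun e => c (tau e)).
Proof.
move=> repc; split=> [homtau|coct]; first exact: cocycle_comp (rep_cocycle repc).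
apply/forall_inP => Z circZ; apply: null_circuit_union repc _.
by rewrite odd_image_sum coct.
Qed.

End Homs.

(** * Recolouring along a dismantling retraction *)

Section Recolouring.
Variables (M N : binMatroid).

Lemma Col_sym : symmetric (@Col M N).
Proof.
move=> t t'; apply: eq_existsb => C; congr (_ && _).
by apply: eq_forallb => e; rewrite eq_sym [t' e == _]eq_sym eq_sym.
Qed.

(** The set where tau and tau' differ is the support of the cocycle
    c o tau' - c o tau, so it contains a cocircuit D. Switching from tau to tau'
    on D alone is one legal step, and it shrinks the set. *)
Lemma connect_translate (V : vectType 'F_2) (c : N -> V) (v : V)
    (tau tau' : hom M N) :
  injective c -> represents c ->
  (forall e, tau e != tau' e -> c (tau' e) = c (tau e) + v) ->
  connect (@Col M N) tau tau'.
Proof.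
move=> injc repc; have [nM [cM [_ repM]]] := bin_matroidP M.
have [m] := ubnP #|[set e | tau e != tau' e]|.
elim: m tau => // m IHm tau lt_m dif.
have homc (t : hom M N) : cocycle (fun e => c (t e)).
  exact/(is_homP _ repc)/hom_funP.
have [/forallP eqt|/forallPn[e0 ne0]] := boolP [forall e, tau e == tau' e].
  have -> : tau = tau' by apply/val_inj/ffunP => e; apply/eqP/eqt.
  exact: connect0.
have cocf : cocycle (fun e => c (tau' e) - c (tau e)).
  by move=> Z circZ; rewrite sumrB !homc ?subr0.
have [|D cocD neD] := @cocycle_cocircuit _ _ _ e0 cocf.
  by rewrite subr_eq0 (inj_eq injc) eq_sym.
have {}neD e : e \in D -> tau e != tau' e.
  by move/neD; rewrite subr_eq0 (inj_eq injc) eq_sym.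
pose t := [ffun e => if e \in D then tau' e else tau e].
have hom_t : is_hom t.
  apply/(is_homP _ repc) => Z circZ.
  rewrite (eq_bigr (fun e => c (tau e) + (e \in D)%:R *: v)); last first.
    move=> e _; rewrite ffunE; case: ifP => [/neD/dif->|_].
      by rewrite scale1r.
    by rewrite scale0r addr0.
  by rewrite big_split /= homc // (cocircuit_cocycleZ repM) ?addr0.
pose t' : hom M N := Hom hom_t.
apply: (@connect_trans _ _ t').
  apply: connect1; apply/existsP; exists D; rewrite cocD.
  apply/forallP => e; rewrite /= ffunE; case: ifP => [/neD->//|_].
  by rewrite eqxx.
apply: IHm => [|e]; last first.
  by rewrite /= ffunE; case: ifP => _; [rewrite eqxx | apply: dif].
apply: leq_trans (proper_card _) lt_m.
have [e eD] := cocircuit_nonempty cocD.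
apply/properP; split; last first.
  by exists e; rewrite !inE ?neD //= ffunE eD eqxx.
apply/subsetP => x; rewrite !inE /= ffunE.
by case: ifP => //; rewrite eqxx.
Qed.

End Recolouring.

Lemma comp_is_hom (M N P : binMatroid) (s : hom N P) (t : hom M N) :
  is_hom [ffun e => s (t e)].
Proof.
have [n [c [_ repc]]] := bin_matroidP P.
apply/(is_homP _ repc) => Z circZ.
have /(cocycle_comp (hom_funP t)) : cocycle (fun y => c (s y)).
  exact/(is_homP _ repc)/hom_funP.
move/(_ Z circZ) => sum0; rewrite -[RHS]sum0.
by apply: eq_bigr => e _; rewrite ffunE.
Qed.

Definition hom_comp (M N P : binMatroid) (s : hom N P) (t : hom M N) :
    hom M P :=
  Hom (comp_is_hom s t).

(** The cocycle c o rho - c is constant on the cocircuit that rho moves, so tau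
    and rho o tau differ by a constant vector wherever they differ. *)
Lemma connect_comp_adj_id (M N : binMatroid) (rho : hom N N) (tau : hom M N) :
  Col rho (hom_id N) -> connect (@Col M N) tau (hom_comp rho tau).
Proof.
have [n [c [injc repc]]] := bin_matroidP N.
case/existsP => C /andP[cocC /forallP difC].
have {}difC y : (rho y != y) = (y \in C).
  by have /eqP <- := difC y; rewrite ffunE.
have [y0 y0C] := cocircuit_nonempty cocC.
pose f y := c (rho y) - c y.
have cocf : cocycle f.
  move=> Z circZ; rewrite sumrB (rep_cocycle repc) // subr0.
  by apply: (cocycle_comp (hom_funP rho) (rep_cocycle repc)).
have fC y : f y != 0 -> y \in C by rewrite subr_eq0 (inj_eq injc) difC.
apply: (@connect_translate _ _ _ c (f y0)) => // e /=.
rewrite ffunE eq_sym difC => eC.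
by rewrite (cocycle_const repc cocC cocf fC y0C eC) addrC subrK.
Qed.

Lemma connect_comp (M N P : binMatroid) (s : hom N P) (t t' : hom M N) :
  injective s -> connect (@Col M N) t t' ->
  connect (@Col M P) (hom_comp s t) (hom_comp s t').
Proof.
move=> injs /connectP[p pth ->]; elim: p t pth => [|u p IHp] t /=.
  by move=> _; apply: connect0.
case/andP => /existsP[C /andP[cocC /forallP difC]] /IHp; apply: connect_trans.
apply: connect1; apply/existsP; exists C; rewrite cocC /=.
by apply/forallP => e; rewrite !ffunE (inj_eq injs).
Qed.

Lemma Recol_trivial_dismantling (N N' : binMatroid) (r : hom N N') :
  dismantling_retraction r -> Recol_trivial N' -> Recol_trivial N.
Proof.
case=> c [[_ rcK] [rho [rhoE adj]]] trivN' [M tau sigma]; rewrite /Recol /=.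
have connM := sym_connect_sym (@Col_sym M N).
have rhoC (t : hom M N) : hom_comp rho t = hom_comp c (hom_comp r t).
  by apply/val_inj/ffunP => e; rewrite !ffunE rhoE.
apply: connect_trans (connect_comp_adj_id tau adj) _.
rewrite connM; apply: connect_trans (connect_comp_adj_id sigma adj) _.
rewrite connM !rhoC; apply: connect_comp; first exact: can_inj rcK.
exact: (trivN' (RecolInstance (hom_comp r tau) (hom_comp r sigma))).
Qed.

Lemma Recol_trivial_point (N : binMatroid) :
  (forall x y : N, x = y) -> Recol_trivial N.
Proof.
move=> pt [M tau sigma]; rewrite /Recol /=.
have -> : tau = sigma by apply/val_inj/ffunP => e; apply: pt.
exact: connect0.
Qed.

Lemma Recol_trivial_dismantles (N N' : binMatroid) :
  (forall x y : N', x = y) -> dismantles N N' -> Recol_trivial N.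
Proof.
move=> pt dN; elim: dN pt => {N N'} [N N' [f [bijf _]] pt|N N1 N' r dr _ IH pt].
  by apply: Recol_trivial_point => x y; apply: (bij_inj bijf); apply: pt.
exact: Recol_trivial_dismantling dr (IH pt).
Qed.

(* The argument N of the theorem is to be explicit. *)
Unset Implicit Arguments.

Theorem corollary3p5 (N : binMatroid) :
  dismantles N loop \/ dismantles N edge -> Recol_trivial N.
Proof. by case; apply: Recol_trivial_dismantles => -[] []. Qed.
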